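(* Consider a binary classification problem: let $(X,Y,A)$ be a random triple with features $X\in\mathbb{R}^d$, ground-truth label $Y\in\{0,1\}$ and sensitive attribute $A\in\{0,1\}$, and let $f_\theta:\mathbb{R}^d\to\{0,1\}$ be a classifier with prediction $C=f_\theta(X)\in\{0,1\}$. Let $(X_i,Y_i,A_i)$ and $(X_j,Y_j,A_j)$ be two independent copies of $(X,Y,A)$, with the pair conditioned on $Y_i\ne Y_j$, and put $A_{ij}=(A_i,A_j)$, $Y_{ij}=\mathrm{sgn}(Y_i-Y_j)\in\{-1,1\}$ and $C_{ij}=\mathrm{sgn}(f_\theta(X_i)-f_\theta(X_j))$. Then comparative separation is equivalent to separation: $$C_{ij}\perp A_{ij}\mid Y_{ij}\quad\Longleftrightarrow\quad C\perp A\mid Y.$$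
   Context: The notation $U\perp V\mid W$ means conditional independence of $U$ and $V$ given $W$, i.e. $P(U=u\mid V=v,W=w)=P(U=u\mid W=w)$ for all values $u,v,w$. A model satisfies separation if $C\perp A\mid Y$ and comparative separation if $C_{ij}\perp A_{ij}\mid Y_{ij}$. Here $\mathrm{sgn}$ is the sign function with $\mathrm{sgn}(0)=0$. A comparative-judgment pair carries a label $Y_{ij}\in\{-1,1\}$, so only pairs with $Y_i\neq Y_j$ are considered. All conditioning events have positive probability, i.e. $P(Y=y,A=a)>0$ for all $y,a\in\{0,1\}$. *)

(* Defs.v *)
From HB Require Import structures.
From mathcomp Require Import all_boot all_order all_algebra.
From mathcomp Require Import all_classical all_reals all_analysis.
Set Implicit Arguments.
Unset Strict Implicit.
Unset Printing Implicit Defensive.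
Import Order.TTheory GRing.Theory Num.Theory.
Local Open Scope classical_set_scope.
Local Open Scope ring_scope.

Definition cprob (R : realType) (dT : measure_display) (T : measurableType dT)
    (P : probability T R) (E F : set T) : R :=
  fine (P (E `&` F)) / fine (P F).

(* P( . | D) as a probability measure. The second argument of [mnormalize] is
   only its fallback value when P D = 0. *)
Definition cond_prob (R : realType) (dT : measure_display)
    (T : measurableType dT) (P : probability T R) (D : set T)
    (mD : measurable D) : probability T R :=
  mnormalize (mrestr P mD) P.

(* U _|_ V | W for discrete variables: P(U=u | V=v, W=w) = P(U=u | W=w)
   whenever the conditioning event {V=v, W=w} has positive probability. *)
Definition cond_indep (R : realType) (dT : measure_display)
    (T : measurableType dT) (P : probability T R) (I J K : countType)
    (U : T -> I) (V : T -> J) (W : T -> K) : Prop :=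
  forall (u : I) (v : J) (w : K),
    (0 < P (V @^-1` [set v] `&` W @^-1` [set w]))%E ->
    cprob P (U @^-1` [set u]) (V @^-1` [set v] `&` W @^-1` [set w]) =
    cprob P (U @^-1` [set u]) (W @^-1` [set w]).

Definition same_law (R : realType) (dT dT' dS : measure_display)
    (T : measurableType dT) (T' : measurableType dT') (S : measurableType dS)
    (P : probability T R) (P' : probability T' R)
    (Z : T -> S) (Z' : T' -> S) : Prop :=
  forall B : set S, measurable B -> P (Z @^-1` B) = P' (Z' @^-1` B).

Definition indep_RV (R : realType) (dT dS1 dS2 : measure_display)
    (T : measurableType dT) (S1 : measurableType dS1)
    (S2 : measurableType dS2) (P : probability T R)
    (Z1 : T -> S1) (Z2 : T -> S2) : Prop :=
  forall (B1 : set S1) (B2 : set S2), measurable B1 -> measurable B2 ->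
    P (Z1 @^-1` B1 `&` Z2 @^-1` B2) = (P (Z1 @^-1` B1) * P (Z2 @^-1` B2))%E.

Definition sgn_diff (b1 b2 : bool) : int :=
  Num.sg ((b1 : nat)%:Z - (b2 : nat)%:Z).

Lemma measurable_neq (dT : measure_display) (T : measurableType dT)
    (Y1 Y2 : {mfun T >-> bool}) :
  measurable [set w | Y1 w != Y2 w].
Proof.
have mY (Y : {mfun T >-> bool}) b : measurable (Y @^-1` [set b]).
  by rewrite -[_ @^-1` _]setTI; exact: measurable_funP.
rewrite (_ : [set w | _] =
    (Y1 @^-1` [set true] `&` Y2 @^-1` [set false]) `|`
    (Y1 @^-1` [set false] `&` Y2 @^-1` [set true])).
  by apply: measurableU; apply: measurableI; exact: mY.
apply/seteqP; split=> w /=; first by case: (Y1 w) (Y2 w) => -[] //; auto.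
by move=> [] [-> ->].
Qed.

(* Main.v *)
(* Conditional independence of U and V given W amounts to a factorization
   P(U = u, V = v, W = w) = g u w * P(V = v, W = w).  Put p(y, a) =
   P(C = 1 | Y = y, A = a).  Given Y_i = y and Y_j = 1 - y, the probabilities of
   C_ij = 1 and C_ij = -1 are p(y, a) (1 - p(1 - y, b)) and
   (1 - p(y, a)) p(1 - y, b); their difference is p(y, a) - p(1 - y, b).
   Comparative separation makes this difference independent of (a, b), so
   p(y, a) does not depend on a.  Conversely, the factors of the two copies
   multiply to a factor for the pair. *)
Require Import Defs.
From HB Require Import structures.
From mathcomp Require Import all_boot all_order all_algebra.
From mathcomp Require Import ring.
From mathcomp Require Import all_classical all_reals all_analysis.
Set Implicit Arguments.
Unset Strict Implicit.
Unset Printing Implicit Defensive.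
Import Order.TTheory GRing.Theory Num.Theory.
Local Open Scope classical_set_scope.
Local Open Scope ring_scope.


(** * Conditional independence of finitely valued variables as a factorization *)

Section FiniteValuedVariables.
Context (R : realType) (dT : measure_display) (T : measurableType dT).
Implicit Types (P : probability T R) (E D : set T).

Lemma fine_prob_cond_prob P D (mD : measurable D) E : measurable E -> P D != 0%E ->
  fine (cond_prob P mD E) = fine (P (E `&` D)) / fine (P D).
Proof.
move=> mE PD0; rewrite /cond_prob /= /mnormalize /= /mrestr setTI.
have PDfin : P D \is a fin_num by exact: fin_num_measure.
(* [mnormalize] also takes its fallback value when the total mass is infinite, which a finite
   measure excludes. *)
rewrite (negbTE PD0) /= ifF; last by apply/eqP => PDoo; rewrite PDoo in PDfin.
rewrite fineM ?fin_num_measure //; exact: measurableI.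
Qed.

Lemma fine_prob_total P (J : finType) (V : T -> J) E :
  (forall v, measurable (V @^-1` [set v])) -> measurable E ->
  fine (P E) = \sum_(v : J) fine (P (E `&` V @^-1` [set v])).
Proof.
move=> mV mE.
rewrite sum_fine => [|v _]; last first.
  by apply: fin_num_measure; exact: measurableI.
congr fine; rewrite fsbig_seq ?index_enum_uniq // -measure_fin_bigcup //.
- congr (P _); apply/seteqP; split=> [w Ew|w [v _ []] //].
    by exists (V w) => //=; rewrite mem_index_enum.
- apply/trivIsetP => u v _ _ uv; apply/seteqP; split=> // w [[_ /= Vu] [_ Vv]].
    by move: uv; rewrite -Vu -Vv eqxx.
- by move=> v _; exact: measurableI.
Qed.

Lemma measurable_preimage_fin (J : finType) (V : T -> J) (B : set J) :
  (forall v, measurable (V @^-1` [set v])) -> measurable (V @^-1` B).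
Proof.
move=> mV; rewrite (_ : _ @^-1` _ = \bigcup_(v in B) V @^-1` [set v]).
  by apply: fin_bigcup_measurable => //; exact: finite_finset.
by apply/seteqP; split=> [w Bw|w [v Bv] /= ->] //; exists (V w).
Qed.

Lemma measurable_preimage_pair (J1 J2 : Type) (V1 : T -> J1) (V2 : T -> J2) :
  (forall v, measurable (V1 @^-1` [set v])) ->
  (forall v, measurable (V2 @^-1` [set v])) ->
  forall v, measurable ((fun w => (V1 w, V2 w)) @^-1` [set v]).
Proof.
move=> mV1 mV2 [v1 v2].
rewrite (_ : _ @^-1` _ = V1 @^-1` [set v1] `&` V2 @^-1` [set v2]).
  exact: measurableI.
by apply/seteqP; split=> w /= [-> ->].
Qed.

(** The factorization involves neither division nor a positivity condition. The factor [g u w] is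
    P(U = u | W = w) in one direction; in the other, finiteness of [J] allows summing over [v]. *)
Lemma cond_indepP P (I K : countType) (J : finType)
    (U : T -> I) (V : T -> J) (W : T -> K) :
  (forall u, measurable (U @^-1` [set u])) ->
  (forall v, measurable (V @^-1` [set v])) ->
  (forall w, measurable (W @^-1` [set w])) ->
  cond_indep P U V W <-> exists g : I -> K -> R, forall u v w,
    fine (P (U @^-1` [set u] `&` (V @^-1` [set v] `&` W @^-1` [set w]))) =
    g u w * fine (P (V @^-1` [set v] `&` W @^-1` [set w])).
Proof.
move=> mU mV mW.
have mVW v w : measurable (V @^-1` [set v] `&` W @^-1` [set w]).
  exact: measurableI.
have fin0 E : measurable E -> (fine (P E) == 0) = (P E == 0%E).
  by move=> mE; rewrite fine_eq0 // fin_num_measure.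
have Pgt0 E : measurable E -> (0 < P E)%E = (fine (P E) != 0).
  by move=> mE; rewrite fin0 // lt0e measure_ge0 andbT.
split=> [UVW|[g gP] u v w].
  exists (fun u w => cprob P (U @^-1` [set u]) (W @^-1` [set w])) => u v w.
  (* On a null conditioning event both sides vanish, the left one by monotonicity. *)
  have [VW0|VW0] := eqVneq (fine (P (V @^-1` [set v] `&` W @^-1` [set w]))) 0.
    rewrite VW0 mulr0; apply/eqP; rewrite fin0; last exact: measurableI.
    rewrite -measure_le0; move/eqP: VW0; rewrite fin0 // => /eqP <-.
    by apply: le_measure; rewrite ?inE //; apply: measurableI.
  by rewrite -(UVW u v w) ?Pgt0 // /cprob divfK.
(* Summing over [v] keeps the factor [g u w], so both conditional probabilities equal it. *)
have UW : fine (P (U @^-1` [set u] `&` W @^-1` [set w])) =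
    g u w * fine (P (W @^-1` [set w])).
  rewrite (fine_prob_total P mV) ?(fine_prob_total P mV (mW w)).
    rewrite mulr_sumr; apply: eq_bigr => v' _.
    by rewrite -setIA ![W @^-1` _ `&` _]setIC gP.
  exact: measurableI.
rewrite Pgt0 // => VW0; rewrite /cprob gP UW !mulfK //.
rewrite -Pgt0 //; apply: (@lt_le_trans _ _ (P (V @^-1` [set v] `&` W @^-1` [set w]))).
  by rewrite Pgt0.
by apply: le_measure; rewrite ?inE.
Qed.

End FiniteValuedVariables.

Lemma fine_indep_copies (R : realType) (dT dT' dS : measure_display)
    (T : measurableType dT) (T' : measurableType dT') (S : measurableType dS)
    (P : probability T R) (P' : probability T' R)
    (Z : T -> S) (Z1 Z2 : T' -> S) :
  measurable_fun setT Z -> same_law P' P Z1 Z -> same_law P' P Z2 Z ->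
  indep_RV P' Z1 Z2 ->
  forall B1 B2 : set S, measurable B1 -> measurable B2 ->
  fine (P' (Z1 @^-1` B1 `&` Z2 @^-1` B2)) =
  fine (P (Z @^-1` B1)) * fine (P (Z @^-1` B2)).
Proof.
move=> mZ law1 law2 indep B1 B2 mB1 mB2; rewrite indep // law1 // law2 //.
have mZB B : measurable B -> measurable (Z @^-1` B).
  by move=> mB; rewrite -[_ @^-1` _]setTI; exact: mZ.
by rewrite fineM ?fin_num_measure //; exact: mZB.
Qed.

Lemma sgn_diff_neq (y y1 y2 : bool) :
  y1 != y2 -> sgn_diff y1 y2 = sgn_diff y (~~ y) -> y1 = y /\ y2 = ~~ y.
Proof. by case: y; case: y1; case: y2. Qed.

(** * The conditioned law of a pair in terms of the masses of one copy *)

Section ComparativePairs.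
Context (R : realType) (d : nat)
    (dT : measure_display) (T : measurableType dT) (P : probability T R)
    (X : {RV P >-> d.-tuple R}) (Y A : {RV P >-> bool})
    (f : {mfun d.-tuple R >-> bool})
    (dT' : measure_display) (T' : measurableType dT') (P' : probability T' R)
    (Xi Xj : {RV P' >-> d.-tuple R}) (Yi Yj Ai Aj : {RV P' >-> bool})
    (hpos : forall y a : bool,
      (0 < P (Y @^-1` [set y] `&` A @^-1` [set a]))%E)
    (hcopyi : same_law P' P (fun w => (Xi w, Yi w, Ai w))
                            (fun w => (X w, Y w, A w)))
    (hcopyj : same_law P' P (fun w => (Xj w, Yj w, Aj w))
                            (fun w => (X w, Y w, A w)))
    (hindep : indep_RV P' (fun w => (Xi w, Yi w, Ai w))
                          (fun w => (Xj w, Yj w, Aj w))).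

Let D := [set w | Yi w != Yj w].
Let mD : measurable D := measurable_neq Yi Yj.
(** The rate p(y, a) is [q true y a / n y a]; working with joint masses postpones the division. *)
Let q (c y a : bool) : R :=
  fine (P ((f \o X) @^-1` [set c] `&` (A @^-1` [set a] `&` Y @^-1` [set y]))).
Let n (y a : bool) : R := fine (P (A @^-1` [set a] `&` Y @^-1` [set y])).

Let mfib dU (U : measurableType dU) (V : {mfun U >-> bool}) b :
  measurable (V @^-1` [set b]).
Proof. by exact: measurable_funPTI. Qed.

Let mfibf dU (U : measurableType dU) (V : {mfun U >-> d.-tuple R}) b :
  measurable ((f \o V) @^-1` [set b]).
Proof.
rewrite comp_preimage; apply: measurable_funPTI.
exact: mfib.
Qed.

Let n_gt0 y a : 0 < n y a.
Proof.
rewrite /n setIC fine_gt0 // hpos /= ltey_eq fin_num_measure //.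
by apply: measurableI; exact: mfib.
Qed.

Let nE y a : n y a = q true y a + q false y a.
Proof.
rewrite /n (fine_prob_total P (mfibf X)); last by apply: measurableI; exact: mfib.
by rewrite big_bool /= ![_ `&` (f \o X) @^-1` _]setIC.
Qed.

Let sum_nn y1 y2 a b :
  \sum_(c : bool * bool) q c.1 y1 a * q c.2 y2 b = n y1 a * n y2 b.
Proof.
rewrite -(pair_bigA _ (fun c1 c2 => q c1 y1 a * q c2 y2 b)) /= !big_bool /=.
rewrite !nE; ring.
Qed.

Let mpair (p : pred (bool * bool)) y1 y2 a b :
  measurable [set w | [/\ p (f (Xi w), f (Xj w)), (Yi w, Ai w) = (y1, a)
                        & (Yj w, Aj w) = (y2, b)]].
Proof.
have mC := measurable_preimage_pair (mfibf Xi) (mfibf Xj).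
have mYAi := measurable_preimage_pair (mfib Yi) (mfib Ai).
have mYAj := measurable_preimage_pair (mfib Yj) (mfib Aj).
have mZ := measurable_preimage_pair mC (measurable_preimage_pair mYAi mYAj).
exact: (measurable_preimage_fin
  [set z | [/\ p z.1, z.2.1 = (y1, a) & z.2.2 = (y2, b)]] mZ).
Qed.

(** Splitting by the two predictions leaves cells that constrain each copy separately; independence
    and equality of laws turn each cell into a product of two values of [q]. *)
Let pair_law (p : pred (bool * bool)) y1 y2 a b :
  fine (P' [set w | [/\ p (f (Xi w), f (Xj w)), (Yi w, Ai w) = (y1, a)
                      & (Yj w, Aj w) = (y2, b)]]) =
  \sum_(c | p c) q c.1 y1 a * q c.2 y2 b.
Proof.
have mC := measurable_preimage_pair (mfibf Xi) (mfibf Xj).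
rewrite (fine_prob_total P' mC); last exact: mpair.
rewrite [RHS]big_mkcond; apply: eq_bigr => -[c1 c2] _; case: ifP => pc; last first.
  rewrite (_ : _ `&` _ = set0) ?measure0 //.
  by apply/seteqP; split=> // w /= [[+ _ _] [e1 e2]]; rewrite /= e1 e2 pc.
(* The hypotheses on the copies concern events of the triple (X, Y, A), so the prediction is
   expressed as a condition on the features. *)
pose B c y a : set (d.-tuple R * bool * bool) :=
  f @^-1` [set c] `*` [set y] `*` [set a].
have mB c y a' : measurable (B c y a').
  by apply: measurableX => //; apply: measurableX => //; exact: mfib.
have qE c y a' : q c y a' = fine (P ((fun w => (X w, Y w, A w)) @^-1` B c y a')).
  rewrite /q; congr (fine (P _)).
  by apply/seteqP; split=> w /= => [[? [? ?]]|[[? ?] ?]].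
rewrite !qE -(fine_indep_copies _ hcopyi hcopyj hindep) //; last first.
  apply: measurable_fun_pair; first apply: measurable_fun_pair.
  - exact: (measurable_funP X).
  - exact: (measurable_funP Y).
  - exact: (measurable_funP A).
congr (fine (P' _)); apply/seteqP; split=> w; rewrite /B /=.
  by move=> [[_ [-> ->] [-> ->]] [-> ->]].
by move=> [[[-> ->] ->] [[-> ->] ->]].
Qed.

(** [D] contains the pairs with labels 1 and 0 and both attributes 1, whose mass is a product of two
    positive numbers. Hence [cond_prob] is a genuine conditional probability here. *)
Let D_gt0 : 0 < fine (P' D).
Proof.
have := pair_law predT true false true true; rewrite sum_nn => pairE.
apply: (@lt_le_trans _ _ (n true true * n false true)); first exact: mulr_gt0.
rewrite -pairE -lee_fin !fineK ?fin_num_measure //.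
apply: le_measure; rewrite ?inE //.
by move=> w [_ [yi _] [yj _]]; rewrite /D /= yi yj.
Qed.

Let sgn_diff_preimage y :
  (fun w => sgn_diff (Yi w) (Yj w)) @^-1` [set sgn_diff y (~~ y)] `&` D =
  Yi @^-1` [set y] `&` Yj @^-1` [set ~~ y].
Proof.
apply/seteqP; split=> w; rewrite /D /= => -[].
  by move=> Yw Dw; apply: sgn_diff_neq.
by move=> -> ->; split=> //; case: y.
Qed.

Let mYij t : measurable ((fun w => sgn_diff (Yi w) (Yj w)) @^-1` [set t]).
Proof.
exact: (measurable_preimage_fin [set z | sgn_diff z.1 z.2 = t]
  (measurable_preimage_pair (mfib Yi) (mfib Yj))).
Qed.

Let mCij s :
  measurable ((fun w => sgn_diff (f (Xi w)) (f (Xj w))) @^-1` [set s]).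
Proof.
exact: (measurable_preimage_fin [set z | sgn_diff z.1 z.2 = s]
  (measurable_preimage_pair (mfibf Xi) (mfibf Xj))).
Qed.

Let mAij := measurable_preimage_pair (mfib Ai) (mfib Aj).

(** Inside [D] the sign of the label difference determines both labels, so [pair_law] applies;
    conditioning only divides by the mass of [D]. *)
Let cond_joint s y a b :
  fine (cond_prob P' mD
    ((fun w => sgn_diff (f (Xi w)) (f (Xj w))) @^-1` [set s] `&`
     ((fun w => (Ai w, Aj w)) @^-1` [set (a, b)] `&`
      (fun w => sgn_diff (Yi w) (Yj w)) @^-1` [set sgn_diff y (~~ y)]))) =
  (\sum_(c | sgn_diff c.1 c.2 == s) q c.1 y a * q c.2 (~~ y) b) / fine (P' D).
Proof.
rewrite fine_prob_cond_prob; [|by do ?apply: measurableI|]; last first.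
  by apply: contraTN D_gt0 => /eqP ->; rewrite ltxx.
rewrite -pair_law -!setIA sgn_diff_preimage; congr (fine (P' _) / _).
apply/seteqP; split=> w /=.
  by move=> [-> [[-> ->] [-> ->]]].
by move=> [/eqP -> [-> ->] [-> ->]].
Qed.

Let cond_marginal y a b :
  fine (cond_prob P' mD
    ((fun w => (Ai w, Aj w)) @^-1` [set (a, b)] `&`
     (fun w => sgn_diff (Yi w) (Yj w)) @^-1` [set sgn_diff y (~~ y)])) =
  n y a * n (~~ y) b / fine (P' D).
Proof.
rewrite fine_prob_cond_prob; [|by do ?apply: measurableI|]; last first.
  by apply: contraTN D_gt0 => /eqP ->; rewrite ltxx.
rewrite -sum_nn -(pair_law predT) -!setIA sgn_diff_preimage.
congr (fine (P' _) / _); apply/seteqP; split=> w /=.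
  by move=> [[-> ->] [-> ->]].
by move=> [_ [-> ->] [-> ->]].
Qed.

(** Ties are excluded from [D], so every integer other than 1 and -1, in particular 0, is a null
    value of the label sign. *)
Let cond_joint0 E t : t != sgn_diff true false -> t != sgn_diff false true ->
  measurable E ->
  fine (cond_prob P' mD (E `&` (fun w => sgn_diff (Yi w) (Yj w)) @^-1` [set t]))
  = 0.
Proof.
move=> t1 t2 mE; rewrite fine_prob_cond_prob; [|exact: measurableI|]; last first.
  by apply: contraTN D_gt0 => /eqP ->; rewrite ltxx.
rewrite (_ : _ `&` D = set0) ?measure0 ?mul0r //.
apply/seteqP; split=> // w [[_ /= tE]].
by move: t1 t2; rewrite -tE /D /=; case: (Yi w); case: (Yj w).
Qed.

(** * The two factorizations and their equivalence *)

Let separationP : cond_indep P (f \o X) A Y <->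
  exists g : bool -> bool -> R, forall c a y, q c y a = g c y * n y a.
Proof. exact: cond_indepP (mfibf X) (mfib A) (mfib Y). Qed.

(** The mass of [D] cancels, and the two label signs are indexed by the label [y] of the first
    copy. *)
Let comparative_separationP :
  cond_indep (cond_prob P' mD)
    (fun w => sgn_diff (f (Xi w)) (f (Xj w)))
    (fun w => (Ai w, Aj w))
    (fun w => sgn_diff (Yi w) (Yj w)) <->
  exists h : int -> bool -> R, forall s y a b,
    \sum_(c | sgn_diff c.1 c.2 == s) q c.1 y a * q c.2 (~~ y) b =
    h s y * (n y a * n (~~ y) b).
Proof.
have D0 := lt0r_neq0 D_gt0.
apply: iff_trans (cond_indepP (cond_prob P' mD) (J := (bool * bool)%type)
  mCij mAij mYij) _; split=> [[g gP]|[h hP]].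
  exists (fun s y => g s (sgn_diff y (~~ y))) => s y a b.
  have := gP s (a, b) (sgn_diff y (~~ y)).
  by rewrite cond_joint cond_marginal mulrA => /(divIf D0).
(* The test recovers [y] from the sign; at values other than 1 and -1 both sides are 0, whatever the
   factor. *)
exists (fun s t => h s (t == sgn_diff true false)) => s [a b] t.
have [->|t1] := eqVneq t (sgn_diff true false).
  by rewrite (cond_joint s true) (cond_marginal true) hP -mulrA.
have [->|t2] := eqVneq t (sgn_diff false true).
  by rewrite (cond_joint s false) (cond_marginal false) hP -mulrA.
by rewrite setIA !cond_joint0 ?mulr0 //; apply: measurableI.
Qed.

Lemma comparative_separation_iff :
  cond_indep (cond_prob P' mD)
    (fun w => sgn_diff (f (Xi w)) (f (Xj w)))
    (fun w => (Ai w, Aj w))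
    (fun w => sgn_diff (Yi w) (Yj w))
  <-> cond_indep P (f \o X) A Y.
Proof.
apply: (iff_trans comparative_separationP).
apply: iff_trans (iff_sym separationP).
split=> [[h hP]|[g gP]].
  have rate y a b : q true y a / n y a - q true (~~ y) b / n (~~ y) b =
      h (sgn_diff true false) y - h (sgn_diff false true) y.
    have := hP (sgn_diff true false) y a b; have := hP (sgn_diff false true) y a b.
    (* Each nonzero sign comes from exactly one pair of predictions, so the sums reduce to single
       terms. *)
    rewrite (big_pred1 (false, true)) => [e1|[[] []]] //.
    rewrite (big_pred1 (true, false)) => [e2|[[] []]] //.
    have ny := lt0r_neq0 (n_gt0 y a); have ny' := lt0r_neq0 (n_gt0 (~~ y) b).
    have nn := mulf_neq0 ny ny'.
    apply: (mulIf nn); rewrite [RHS]mulrBl -e1 -e2 /=.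
    (* After clearing denominators, [nE] expands the masses [n] and the products of two [q true]
       terms cancel. *)
    have -> : (q true y a / n y a - q true (~~ y) b / n (~~ y) b) *
       (n y a * n (~~ y) b) = q true y a * n (~~ y) b - q true (~~ y) b * n y a.
      by field; rewrite ny ny'.
    by rewrite !nE; ring.
  (* With [b] fixed, the rate of the second copy is a common term and cancels. *)
  have rate_indep y a : q true y a / n y a = q true y false / n y false.
    by have := rate y a false; rewrite -(rate y false false) => /addIr.
  (* The group [false] serves as reference; prediction [false] then follows by complement. *)
  exists (fun c y => q c y false / n y false) => c a y.
  have na := lt0r_neq0 (n_gt0 y a); have n0 := lt0r_neq0 (n_gt0 y false).
  case: c; first by rewrite -(rate_indep y a) divfK.
  have qF b : q false y b = n y b - q true y b by rewrite nE; ring.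
  by rewrite !qF mulrBl divff // -(rate_indep y a); field.
(* The sum adds up the products of the factors of the two copies; for [s] = 0 it collects both tied
   pairs of predictions. *)
exists (fun s y => \sum_(c : bool * bool | sgn_diff c.1 c.2 == s)
  g c.1 y * g c.2 (~~ y)) => s y a b.
by rewrite mulr_suml; apply: eq_bigr => c _; rewrite !gP mulrACA.
Qed.

End ComparativePairs.

Theorem theorem3p3 (R : realType) (d : nat)
    (dT : measure_display) (T : measurableType dT) (P : probability T R)
    (X : {RV P >-> d.-tuple R}) (Y A : {RV P >-> bool})
    (f : {mfun d.-tuple R >-> bool})
    (dT' : measure_display) (T' : measurableType dT') (P' : probability T' R)
    (Xi Xj : {RV P' >-> d.-tuple R}) (Yi Yj Ai Aj : {RV P' >-> bool})
    (hpos : forall y a : bool,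
      (0 < P (Y @^-1` [set y] `&` A @^-1` [set a]))%E)
    (hcopyi : same_law P' P (fun w => (Xi w, Yi w, Ai w))
                            (fun w => (X w, Y w, A w)))
    (hcopyj : same_law P' P (fun w => (Xj w, Yj w, Aj w))
                            (fun w => (X w, Y w, A w)))
    (hindep : indep_RV P' (fun w => (Xi w, Yi w, Ai w))
                          (fun w => (Xj w, Yj w, Aj w))) :
  cond_indep (cond_prob P' (measurable_neq Yi Yj))
    (fun w => sgn_diff (f (Xi w)) (f (Xj w)))
    (fun w => (Ai w, Aj w))
    (fun w => sgn_diff (Yi w) (Yj w))
  <->
  cond_indep P (f \o X) A Y.
Proof. exact: comparative_separation_iff. Qed.
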